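(* Let $f:\mathbb{R}^n\times[0,\infty)\to\mathbb{R}^n$ be continuous and let $s:[0,\infty)\to\mathbb{R}^n$ be a solution of $\dot s(t)=f(s(t),t)$. Let $A=(a_{ij})\in\mathbb{R}^{m\times m}$ be symmetric and irreducible with $a_{ij}\ge 0$ for $i\neq j$ and $\sum_{j=1}^m a_{ij}=0$ for all $i$. Let $c>0$, $\varepsilon>0$, and let $\tilde A$ be the matrix obtained from $A$ by replacing $a_{11}$ by $a_{11}-\varepsilon$. Let $0>\lambda_1\ge\cdots\ge\lambda_m$ be the eigenvalues of $\tilde A$. Suppose there are diagonal matrices with positive diagonal entries $P=\operatorname{diag}\{p_1,\dots,p_n\}$, $\Delta=\operatorname{diag}\{\Delta_1,\dots,\Delta_n\}$ and a constant $\eta>0$ such that $$(x-y)^{\top}P\big(f(x,t)-\Delta x-f(y,t)+\Delta y\big)\le-\eta\,(x-y)^{\top}(x-y)\qquad\text{for all }x,y\in\mathbb{R}^n,\ t\ge 0,$$ and $\Delta_k+c\lambda_1<0$ for $k=1,\dots,n$. Then the controlled network $$\dot x_1=f(x_1,t)+c\sum_{j=1}^m a_{1j}x_j-c\varepsilon(x_1-s(t)),\qquad \dot x_i=f(x_i,t)+c\sum_{j=1}^m a_{ij}x_j\quad(i=2,\dots,m),$$ is globally exponentially synchronized to $s(t)$.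
   Context: Here $x_i(t)\in\mathbb{R}^n$ is the state of node $i$. ''Globally exponentially synchronized to $s(t)$'' means: there is a constant $\gamma>0$ such that for every solution $(x_1,\dots,x_m)$ of the controlled network on $[0,\infty)$ (with arbitrary initial values), $\|x_i(t)-s(t)\|=O(e^{-\gamma t})$ as $t\to\infty$ for all $i=1,\dots,m$. *)

(* Defs.v *)
From HB Require Import structures.
From mathcomp Require Import all_boot all_order all_algebra all_fingroup.
From mathcomp Require Import all_classical all_reals all_analysis.

Set Implicit Arguments.
Unset Strict Implicit.
Unset Printing Implicit Defensive.

Import Order.TTheory GRing.Theory Num.Theory.
Import numFieldNormedType.Exports.

Local Open Scope classical_set_scope.
Local Open Scope ring_scope.

(* Lets =O_ be used at +oo. *)
Canonical pinfty_filter_on (R : realType) :=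
  FilterType (pinfty_nbhs R) (@filter_filter R _ proper_pinfty_nbhs).

Definition enorm (R : realType) (n : nat) (v : 'cV[R]_n) : R :=
  Num.sqrt ((v^T *m v) 0 0).

(* A simultaneous permutation of rows and columns brings A to block upper
   triangular form, with nonempty square diagonal blocks of sizes k and m - k. *)
Definition reducible_mx (R : realType) (m : nat) (A : 'M[R]_m) : Prop :=
  exists (s : 'S_m) (k : nat), (0 < k < m)%N /\
    forall i j : 'I_m, (k <= i)%N -> (j < k)%N ->
      row_perm s (col_perm s A) i j = 0.

Definition irreducible_mx (R : realType) (m : nat) (A : 'M[R]_m) : Prop :=
  ~ reducible_mx A.

Definition pinned_mx (R : realType) (m : nat) (eps : R) (A : 'M[R]_m.+1) :
    'M[R]_m.+1 :=
  \matrix_(i, j) if (i == ord0) && (j == ord0) then A i j - eps else A i j.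

(* The derivative of x on [0, +oo[ is v: for t > 0 the limit is two-sided, and
   at t = 0 it is the right derivative.  The values of x at negative times play
   no role. *)
Definition has_derivative_ge0 (R : realType) (n : nat)
    (x v : R -> 'cV[R]_n) : Prop :=
  forall t : R, 0 <= t ->
    h^-1 *: (x (t + h) - x t) @[h --> within [set h | 0 <= t + h] 0^']
      --> v t.

Definition network_solution (R : realType) (n m : nat)
    (f : 'cV[R]_n -> R -> 'cV[R]_n) (s : R -> 'cV[R]_n)
    (A : 'M[R]_m.+1) (c eps : R) (x : 'I_m.+1 -> R -> 'cV[R]_n) : Prop :=
  has_derivative_ge0 (x ord0)
    (fun t => f (x ord0 t) t + c *: (\sum_j A ord0 j *: x j t)
              - (c * eps) *: (x ord0 t - s t)) /\
  forall i : 'I_m.+1, i != ord0 ->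
    has_derivative_ge0 (x i)
      (fun t => f (x i t) t + c *: (\sum_j A i j *: x j t)).

(* The rate gamma is chosen before the solution x; the constant hidden in the
   big-O may depend on x. *)
Definition globally_exp_synchronized (R : realType) (n m : nat)
    (f : 'cV[R]_n -> R -> 'cV[R]_n) (s : R -> 'cV[R]_n)
    (A : 'M[R]_m.+1) (c eps : R) : Prop :=
  exists2 gamma : R, 0 < gamma &
    forall x : 'I_m.+1 -> R -> 'cV[R]_n, network_solution f s A c eps x ->
    forall i : 'I_m.+1,
      (fun t => enorm (x i t - s t)) =O_ +oo (fun t => expR (- gamma * t)).

(* Main.v *)
Require Import Defs.
From HB Require Import structures.
From mathcomp Require Import all_boot all_order all_algebra all_fingroup.
From mathcomp Require Import all_classical all_reals all_analysis.
From mathcomp Require Import ring lra complex.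

Import Order.TTheory GRing.Theory Num.Theory.
Import numFieldNormedType.Exports.

Local Open Scope classical_set_scope.
Local Open Scope ring_scope.

(* With e_i = x_i - s and V = sum_i e_i^T P e_i, the zero row sums of A let one
   subtract s inside the coupling, so e' = f(x) - f(s) + c A~ e.  Splitting
   f = (f - Delta) + Delta, the first part contributes at most -2 eta |e|^2 to
   V', and for each coordinate k the rest contributes at most
   2 p_k (Delta_k + c lambda_1) sum_i (e_i)_k^2 <= 0, since lambda_1 dominates
   the Rayleigh quotient of the symmetric matrix A~.  Hence V' <= - 2 gamma V with
   gamma = eta / M for any upper bound M > 0 of the p_k, and e decays like
   exp (- gamma t).  Starting the decay estimate at t = 1 avoids the one-sided
   derivative at 0. *)

(** * Rayleigh bound for real symmetric matrices *)

(** Over [R[i]] the matrix is Hermitian, hence [S^-1 diag(d) S] with [S] unitary. In the coordinates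
    [w = S u] the form is [sum_i d_i |w_i|^2], and [S] preserves the norm, so bounding each [d_i] by
    [l] suffices. *)
Lemma sym_mx_rayleigh (R : rcfType) (n : nat) (B : 'M[R]_n) (l : R) :
  B^T = B -> (forall x, root (char_poly B) x -> x <= l) ->
  forall u : 'I_n -> R,
    \sum_i \sum_j u i * B i j * u j <= l * \sum_i u i ^+ 2.
Proof.
move=> B_sym B_le u.
pose toC : {rmorphism R -> R[i]} := real_complex R.
have toC_le a b : (toC a <= toC b) = (a <= b) by exact: lecR.
pose BC := map_mx toC B.
pose S := spectralmx BC; pose d := spectral_diag BC.
have BC_herm : BC \is hermsymmx.
  apply: realsym_hermsym.
    apply/is_hermitianmxP.
    by rewrite expr0 scale1r map_mx_id // /BC map_trmx B_sym.
  by apply/mxOverP => i j; rewrite mxE; apply/complex_realP; exists (B i j).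
have S_unit : S \in unitmx by exact: spectral_unit.
have BC_eq : BC = invmx S *m diag_mx d *m S.
  exact/orthomx_spectralP/hermitian_normalmx.
have d_le i : d 0 i <= toC l.
  have d_real : d 0 i \is Num.real.
    exact: (mxOverP (hermitian_spectral_diag_real BC_herm)).
  have /complex_realP[r dr] := d_real.
  (* Row i of S is an eigenvector of BC because S BC = diag(d) S. *)
  have : eigenvalue BC (d 0 i).
    apply/eigenvalueP; exists (row i S).
      rewrite -row_mul BC_eq !mulmxA mulmxV // mul1mx row_mul.
      by rewrite row_diag_mx -scalemxAl -rowE.
    (* A zero row [i] of [S] would make row [i] of [S *m S' = 1] vanish, although its diagonal entry
       is 1. *)
    by apply: contraTneq S_unit; rewrite -row_free_unit => Si0;
      apply/negP => /row_freeP[S' /(congr1 (row i))]; rewrite row_mul Si0 mul0mx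
      => /rowP/(_ i); rewrite !mxE eqxx => /esym/eqP; rewrite oner_eq0.
  (* As [d 0 i] is the image of the real [r], being a root descends to the real characteristic
     polynomial, where [B_le] applies. *)
  rewrite eigenvalue_root_char /BC -map_char_poly dr fmorph_root => /B_le.
  by rewrite toC_le.
pose v : 'cV_n := \col_i toC (u i).
pose w := S *m v.
have sum_sq (z : 'cV[R[i]]_n) : (map_mx Num.conj z^T *m z) 0 0 = \sum_i `|z i 0| ^+ 2.
  by rewrite mxE; apply: eq_bigr => i _; rewrite !mxE normCK mulrC.
have v_conj : map_mx Num.conj v^T = v^T.
  apply/matrixP => i j; rewrite !mxE; apply/CrealP/complex_realP.
  by exists (u j).
have wS : map_mx Num.conj w^T = v^T *m invmx S.
  by rewrite /w trmx_mul map_mxM v_conj invmx_unitary ?spectral_unitarymx.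
rewrite -toC_le.
have -> : toC (\sum_i \sum_j u i * B i j * u j) = (v^T *m BC *m v) 0 0.
  rewrite exchange_big rmorph_sum mxE; apply: eq_bigr => j _.
  rewrite rmorph_sum !mxE mulr_suml; apply: eq_bigr => i _.
  by rewrite !mxE !rmorphM.
have -> : toC (l * \sum_i u i ^+ 2) = toC l * (map_mx Num.conj w^T *m w) 0 0.
  rewrite wS mulmxA mulmxKV // rmorphM; congr (_ * _).
  rewrite rmorph_sum mxE; apply: eq_bigr => i _.
  by rewrite !mxE rmorphXn expr2.
have -> : v^T *m BC *m v = map_mx Num.conj w^T *m diag_mx d *m w.
  by rewrite wS BC_eq !mulmxA.
rewrite sum_sq mxE mulr_sumr.
apply: ler_sum => i _.
rewrite mul_mx_diag !mxE normCK [X in X * _]mulrC -mulrA [X in _ <= _ * X]mulrC.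
by rewrite ler_wpM2r // mulrC -normCK exprn_ge0.
Qed.

(** * Coordinate derivatives and exponential decay *)

(** For [t > 0] every [h] with [|h| < t] satisfies [0 <= t + h], so the restricted limit is an
    ordinary two-sided one; projections being continuous, it passes to coordinates. *)
Lemma has_derivative_coord (R : realType) (n : nat) (x v : R -> 'cV[R]_n)
    (t : R) (k : 'I_n) :
  has_derivative_ge0 x v -> 0 < t ->
  is_derive t (1 : R) (fun u => x u k 0) (v t k 0).
Proof.
move=> xv t_gt0; have xvt := xv t (ltW t_gt0).
have quot_cvg : h^-1 *: (x (t + h) - x t) @[h --> 0^'] --> v t.
  apply: cvg_trans xvt; apply: cvg_app => U.
  move=> U_near'; have U_near : \forall h \near (0 : R)^',
    0 <= t + h -> U h by exact: U_near'.
  have h_ge : \forall h \near (0 : R)^', 0 <= t + h.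
    near=> h.
    have : `|h| < t by near: h; apply: dnbhs0_lt.
    by rewrite ltr_norml => /andP[]; lra.
  by apply: filterS2 U_near h_ge => h Uh /Uh.
have coord_cvg :
    h^-1 *: (((fun u => x u k 0) \o shift t) (h *: 1) - x t k 0) @[h --> 0^']
      --> v t k 0.
  rewrite (_ : (fun h : R => h^-1 *: _) =
      (fun M : 'cV[R]_n => M k 0) \o (fun h => h^-1 *: (x (t + h) - x t))).
    exact: cvg_comp quot_cvg (@coord_continuous R n 1 k 0 (v t)).
  by apply/funext => h; rewrite /= !mxE [h *: 1]mulr1 [t + h]addrC.
apply: DeriveDef; first by apply/cvg_ex; exists (v t k 0).
exact: cvg_lim.
Unshelve. all: by end_near. Qed.

(** The product [expR (g * t) * V t] has derivative [expR (g * t) * (dV t + g * V t) <= 0], so it is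
    nonincreasing from [t0] on. *)
Lemma exp_decay (R : realType) (V dV : R -> R) (g t0 : R) :
  (forall t, t0 <= t -> is_derive t (1 : R) V (dV t)) ->
  (forall t, t0 <= t -> dV t <= - g * V t) ->
  forall t, t0 <= t -> V t <= V t0 * expR (g * t0) * expR (- g * t).
Proof.
move=> V_der dV_le t t0t.
pose W u := expR (g * u) * V u.
have W_der u : t0 <= u ->
    is_derive u (1 : R) W (expR (g * u) * (dV u + g * V u)).
  move=> /V_der V_der_u.
  have lin_der : is_derive u (1 : R) (fun z => g * z) g.
    apply: (is_derive_eq (is_deriveM (is_derive_cst g u (1 : R)) (is_derive_id u (1 : R)))).
    by rewrite /GRing.scale /=; ring.
  have exp_der : is_derive u (1 : R) (fun z => expR (g * z)) (expR (g * u) * g).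
    exact: (@is_derive1_comp _ expR (fun z => g * z) u _ _ _ lin_der).
  apply: (@is_derive_eq _ _ _ _ _ _ _ _ (is_deriveM exp_der V_der_u)).
  by rewrite /GRing.scale /=; ring.
have W_le : W t <= W t0.
  apply: (@ler0_derive1_nincry R W t0) => //.
  - by move=> u; rewrite in_itv /= andbT => /ltW/W_der[].
  - move=> u; rewrite in_itv /= andbT => /ltW t0u.
    rewrite derive1E (@derive_val _ _ _ _ _ _ _ (W_der u t0u)).
    have := dV_le u t0u; have := expR_ge0 (g * u); nra.
  - apply: derivable_within_continuous => u; rewrite in_itv /= andbT.
    by move=> /W_der[].
move: W_le; rewrite /W mulrC -ler_pdivlMr ?expR_gt0 // -expRN mulNr.
by rewrite [expR (g * t0) * _]mulrC.
Qed.

(** * Error dynamics of the pinned network *)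

(** Zero row sums cancel [b] in the coupling through [A]; only the modified corner entry still sees
    it. This absorbs the control term into the matrix, giving all nodes one error equation. *)
Lemma pinned_mx_coupling (R : realType) (m : nat) (A : 'M[R]_m.+1) (eps : R)
    (z : 'I_m.+1 -> R) (b : R) (i : 'I_m.+1) :
  (forall i, \sum_j A i j = 0) ->
  \sum_j pinned_mx eps A i j * (z j - b) =
  \sum_j A i j * z j - (if i == ord0 then eps * (z ord0 - b) else 0).
Proof.
move=> A_rowsum.
have split_sum : \sum_j A i j * (z j - b) = \sum_j A i j * z j.
  under eq_bigr do rewrite mulrBr.
  by rewrite sumrB -mulr_suml A_rowsum mul0r subr0.
rewrite -split_sum !big_ord_recl !mxE eqxx andbT.
under eq_bigr do rewrite mxE andbF.
by case: (i == ord0); ring.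
Qed.

Lemma network_solution_derive (R : realType) (n m : nat)
    (f : 'cV[R]_n -> R -> 'cV[R]_n) (s : R -> 'cV[R]_n) (A : 'M[R]_m.+1)
    (c eps : R) (x : 'I_m.+1 -> R -> 'cV[R]_n) (i : 'I_m.+1) (k : 'I_n) (t : R) :
  (forall i, \sum_j A i j = 0) ->
  has_derivative_ge0 s (fun t => f (s t) t) ->
  network_solution f s A c eps x -> 0 < t ->
  is_derive t (1 : R) (fun u => x i u k 0 - s u k 0)
    (f (x i t) t k 0 - f (s t) t k 0 +
     c * \sum_j pinned_mx eps A i j * (x j t k 0 - s t k 0)).
Proof.
move=> A_rowsum s_sol [x0_sol xi_sol] t_gt0.
have s_der := @has_derivative_coord R n _ _ t k s_sol t_gt0.
rewrite (@pinned_mx_coupling R m A eps (fun j => x j t k 0)) //.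
have sum_k : (\sum_j A i j *: x j t) k 0 = \sum_j A i j * x j t k 0.
  by rewrite summxE; apply: eq_bigr => j _; rewrite mxE.
have [i0|i_neq0] := eqVneq i ord0.
  have x_der := @has_derivative_coord R n _ _ t k x0_sol t_gt0.
  rewrite i0 in sum_k *.
  apply: (is_derive_eq (is_deriveB x_der s_der)).
  by rewrite !mxE sum_k; ring.
have x_der := @has_derivative_coord R n _ _ t k (xi_sol i i_neq0) t_gt0.
apply: (is_derive_eq (is_deriveB x_der s_der)).
by rewrite !mxE sum_k; ring.
Qed.

(** * Energy estimate *)

Lemma diag_quad_formE (R : realType) (n : nat) (u w : 'cV[R]_n) (p : 'rV[R]_n) :
  (u^T *m diag_mx p *m w) 0 0 = \sum_k p 0 k * u k 0 * w k 0.
Proof.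
rewrite mul_mx_diag mxE; apply: eq_bigr => k _.
by rewrite !mxE [u k 0 * _]mulrC.
Qed.

(** The pointwise algebra behind the decay of the energy: [e] stands for the errors and [g] for the
    differences of [f]. Exchanging the sums isolates, for each coordinate [k], the quadratic form of
    [B] at the vector of the [e i k]. *)
Lemma energy_dissipation (R : realType) (n N : nat) (B : 'M[R]_N)
    (c eta l : R) (p Delta : 'I_n -> R) (e g : 'I_N -> 'I_n -> R) :
  0 <= c -> (forall k, 0 <= p k) -> (forall k, Delta k + c * l <= 0) ->
  (forall u : 'I_N -> R,
     \sum_i \sum_j u i * B i j * u j <= l * \sum_i u i ^+ 2) ->
  (forall i, \sum_k p k * e i k * (g i k - Delta k * e i k)
             <= - eta * \sum_k e i k ^+ 2) ->
  \sum_i \sum_k p k * e i k * (g i k + c * \sum_j B i j * e j k)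
  <= - eta * \sum_i \sum_k e i k ^+ 2.
Proof.
move=> c_ge0 p_ge0 Delta_le B_le g_le.
have -> : \sum_i \sum_k p k * e i k * (g i k + c * \sum_j B i j * e j k) =
    \sum_i \sum_k p k * e i k * (g i k - Delta k * e i k) +
    \sum_k p k * (Delta k * \sum_i e i k ^+ 2 +
                  c * \sum_i \sum_j e i k * B i j * e j k).
  have -> : \sum_k p k * (Delta k * \sum_i e i k ^+ 2 +
                  c * \sum_i \sum_j e i k * B i j * e j k) =
      \sum_i \sum_k p k * (Delta k * e i k ^+ 2 +
                           c * (e i k * \sum_j B i j * e j k)).
    rewrite exchange_big; apply: eq_bigr => k _.
    rewrite !mulr_sumr -big_split mulr_sumr; apply: eq_bigr => i _ /=.
    congr (_ * (_ + c * _)); rewrite mulr_sumr.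
    by apply: eq_bigr => j _; rewrite mulrA.
  rewrite -big_split; apply: eq_bigr => i _; rewrite -big_split.
  by apply: eq_bigr => k _ /=; ring.
rewrite -[leRHS]addr0 mulr_sumr; apply: lerD; first exact: ler_sum.
apply: sumr_le0 => k _; rewrite mulr_ge0_le0 //.
have sq_ge0 : 0 <= \sum_i e i k ^+ 2 by apply: sumr_ge0 => i _; exact: sqr_ge0.
apply: (@le_trans _ _ ((Delta k + c * l) * \sum_i e i k ^+ 2)).
  by rewrite mulrDl -mulrA lerD2l ler_wpM2l // (B_le (fun i => e i k)).
exact: mulr_le0_ge0.
Qed.

Lemma is_derive_weighted_sq (R : realType) (n N : nat) (p : 'I_n -> R)
    (e : 'I_N -> 'I_n -> R -> R) (de : 'I_N -> 'I_n -> R) (t : R) :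
  (forall i k, is_derive t (1 : R) (e i k) (de i k)) ->
  is_derive t (1 : R) (fun u => \sum_i \sum_k p k * e i k u ^+ 2)
    (2 * \sum_i \sum_k p k * e i k t * de i k).
Proof.
move=> e_der.
(* Function and derivative are put in the shape of the sum and product rules; the two equal terms of
   the product rule account for the factor 2. *)
have -> : (fun u => \sum_i \sum_k p k * e i k u ^+ 2) =
    \sum_i \sum_k (p k \*: (e i k * e i k)).
  apply/funext => u; rewrite fct_sumE; apply: eq_bigr => i _.
  by rewrite fct_sumE; apply: eq_bigr => k _; rewrite expr2.
have -> : 2 * \sum_i \sum_k p k * e i k t * de i k =
    \sum_i \sum_k p k *: (e i k t *: de i k + e i k t *: de i k).
  rewrite mulr_sumr; apply: eq_bigr => i _.
  rewrite mulr_sumr; apply: eq_bigr => k _.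
  by rewrite /GRing.scale /=; ring.
by apply: is_derive_sum => i; apply: is_derive_sum => k.
Qed.

(** * Choice of the rate and the Lyapunov argument *)

Theorem theorem2 (R : realType) (n m : nat)
  (f : 'cV[R]_n -> R -> 'cV[R]_n) (s : R -> 'cV[R]_n)
  (A : 'M[R]_m.+1) (c eps : R) (lambda : 'I_m.+1 -> R)
  (p Delta : 'rV[R]_n) (eta : R)
  (f_cont : {within [set z : 'cV[R]_n * R | 0 <= z.2],
               continuous (fun z : 'cV[R]_n * R => f z.1 z.2)})
  (s_sol : has_derivative_ge0 s (fun t => f (s t) t))
  (A_sym : A^T = A)
  (A_irr : irreducible_mx A)
  (A_offdiag : forall i j, i != j -> 0 <= A i j)
  (A_rowsum : forall i, \sum_j A i j = 0)
  (c_gt0 : 0 < c) (eps_gt0 : 0 < eps)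
  (lambda_eig : char_poly (pinned_mx eps A) = \prod_i ('X - (lambda i)%:P))
  (lambda_sorted : forall i j : 'I_m.+1, (i <= j)%N -> lambda j <= lambda i)
  (lambda_lt0 : lambda ord0 < 0)
  (p_gt0 : forall k, 0 < p 0 k)
  (Delta_gt0 : forall k, 0 < Delta 0 k)
  (eta_gt0 : 0 < eta)
  (f_quad : forall (x y : 'cV[R]_n) (t : R), 0 <= t ->
     ((x - y)^T *m diag_mx p *m
        (f x t - diag_mx Delta *m x - f y t + diag_mx Delta *m y)) 0 0
     <= - eta * ((x - y)^T *m (x - y)) 0 0)
  (Delta_lambda : forall k, Delta 0 k + c * lambda ord0 < 0) :
  globally_exp_synchronized f s A c eps.
Proof.
pose B := pinned_mx eps A.
have sq_normE (u : 'cV[R]_n) : (u^T *m u) 0 0 = \sum_k u k 0 ^+ 2.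
  by rewrite mxE; apply: eq_bigr => k _; rewrite mxE expr2.
have B_sym : B^T = B.
  apply/matrixP => i j; rewrite !mxE andbC.
  by have -> : A j i = A i j by rewrite -{1}A_sym mxE.
have B_le u : \sum_i \sum_j u i * B i j * u j <= lambda ord0 * \sum_i u i ^+ 2.
  apply: sym_mx_rayleigh => // z; rewrite lambda_eig.
  (* The roots are exactly the values of [lambda], and the ordering makes [lambda ord0] the
     largest. *)
  rewrite -(big_map lambda predT (fun y => 'X - y%:P)) root_prod_XsubC.
  by case/mapP => i _ ->; exact: lambda_sorted.
(* The summand 1 keeps [M] positive even when [n = 0]. *)
pose M := 1 + \sum_k p 0 k.
have sum_p_ge0 : 0 <= \sum_k p 0 k by apply: sumr_ge0 => k _; exact: ltW.
have M_gt0 : 0 < M by rewrite /M; lra.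
have p_le k : p 0 k <= M.
  rewrite /M (bigD1 k) //=.
  have : 0 <= \sum_(i | i != k) p 0 i by apply: sumr_ge0 => i _; exact: ltW.
  by lra.
pose gamma := eta / M.
have gamma_gt0 : 0 < gamma by exact: divr_gt0.
exists gamma => // x x_sol.
pose e i k t := x i t k 0 - s t k 0.
pose V t := \sum_i \sum_k p 0 k * e i k t ^+ 2.
pose g i k t := f (x i t) t k 0 - f (s t) t k 0.
pose dV t := 2 * \sum_i \sum_k p 0 k * e i k t *
                     (g i k t + c * \sum_j B i j * e j k t).
have V_ge0 t : 0 <= V t.
  apply: sumr_ge0 => i _; apply: sumr_ge0 => k _.
  by rewrite mulr_ge0 ?sqr_ge0 // ltW.
have V_der (t : R) : 1 <= t -> is_derive t (1 : R) V (dV t).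
  move=> t_ge1; apply: is_derive_weighted_sq => i k.
  by apply: network_solution_derive => //; exact: lt_le_trans t_ge1.
have dV_le (t : R) : 1 <= t -> dV t <= - (2 * gamma) * V t.
  move=> t_ge1.
  have diss : \sum_i \sum_k p 0 k * e i k t *
                     (g i k t + c * \sum_j B i j * e j k t)
      <= - eta * \sum_i \sum_k e i k t ^+ 2.
    apply: (@energy_dissipation _ _ _ B c eta (lambda ord0)
              (p 0) (Delta 0) (fun i k => e i k t) (fun i k => g i k t)).
    - exact: ltW.
    - by move=> k; exact: ltW.
    - by move=> k; exact: ltW.
    - exact: B_le.
    (* The hypothesis [f_quad] at [x i t] and [s t], written in coordinates, is the required bound
       up to rearranging each summand. *)
    - move=> i; have := f_quad (x i t) (s t) t (le_trans ler01 t_ge1).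
      rewrite diag_quad_formE sq_normE.
      under eq_bigr => k _ do rewrite mul_diag_mx mul_diag_mx !mxE.
      under [X in _ <= _ * X]eq_bigr => k _ do rewrite !mxE.
      apply: le_trans; rewrite le_eqVlt; apply/orP; left; apply/eqP.
      by apply: eq_bigr => k _; rewrite /g /e; ring.
  (* Termwise, [gamma * p 0 k <= eta] because [p 0 k <= M]. *)
  have gammaV : gamma * V t <= eta * \sum_i \sum_k e i k t ^+ 2.
    rewrite /V !mulr_sumr; apply: ler_sum => i _.
    rewrite !mulr_sumr; apply: ler_sum => k _.
    rewrite mulrA ler_wpM2r ?sqr_ge0 // /gamma mulrAC ler_pdivrMr //.
    by rewrite ler_wpM2l // ltW.
  by rewrite /dV; lra.
have V_le := @exp_decay R V dV (2 * gamma) 1 V_der dV_le.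
(* Each squared coordinate of an error is at most [V t / p 0 k], the other terms of [V] being
   nonnegative; summing over [k] gives the factor [N]. *)
pose N := \sum_k (p 0 k)^-1.
have norm_le i t : enorm (x i t - s t) ^+ 2 <= N * V t.
  have sq_ge0 : 0 <= ((x i t - s t)^T *m (x i t - s t)) 0 0.
    by rewrite sq_normE; apply: sumr_ge0 => k _; exact: sqr_ge0.
  rewrite /enorm sqr_sqrtr // sq_normE /N mulr_suml; apply: ler_sum => k _.
  rewrite ler_pdivlMl // /V (bigD1 i) //= (bigD1 k) //= !mxE -!addrA lerDl.
  apply: addr_ge0.
    by apply: sumr_ge0 => k' _; rewrite mulr_ge0 ?sqr_ge0 // ltW.
  apply: sumr_ge0 => i' _; apply: sumr_ge0 => k' _.
  by rewrite mulr_ge0 ?sqr_ge0 // ltW.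
move=> i; apply/eqO_exP.
pose K := Num.sqrt (N * V 1 * expR (2 * gamma)).
(* The big-O constant must be positive, whereas [K] may be zero. *)
exists (K + 1); first by rewrite ltr_wpDl // sqrtr_ge0.
near=> t.
have t_ge1 : 1 <= t by near: t; apply: nbhs_pinfty_ge; rewrite num_real.
have N_ge0 : 0 <= N by apply: sumr_ge0 => k _; rewrite invr_ge0 ltW.
rewrite !ger0_norm ?expR_ge0 ?sqrtr_ge0 //.
apply: (@le_trans _ _ (K * expR (- gamma * t))); last first.
  by rewrite ler_wpM2r ?expR_ge0 // lerDl.
(* Both sides are nonnegative, so squares may be compared; squaring turns the rate [gamma] into the
   rate [2 * gamma] of [V]. *)
rewrite -ler_sqr ?nnegrE ?mulr_ge0 ?expR_ge0 ?sqrtr_ge0 //.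
apply: (le_trans (norm_le i t)).
rewrite exprMn sqr_sqrtr ?mulr_ge0 ?expR_ge0 //.
rewrite -!mulrA ler_wpM2l // -expRM_natl mulrA.
have := V_le t t_ge1; rewrite mulr1.
by congr (_ <= _ * expR _); ring.
Unshelve. all: by end_near. Qed.
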